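(* Let $a\in\mathbb{Z}^n$ be a row vector with positive components whose greatest common divisor is $1$, and suppose $\|a\|\ge 2^{(n/2+1)n}$. Let $U$ be an $n\times n$ unimodular matrix such that the columns of $$\begin{pmatrix} a\\ I\end{pmatrix}U$$ are LLL-reduced, and let $p$ be the last row of $U^{-1}$. Let $\lambda\in\mathbb{Q}$ and $r\in\mathbb{Q}^n$ be defined by $a=\lambda p+r$ with $r\perp p$, and assume without loss of generality (replacing $p$ by $-p$ if necessary) that $\lambda>0$. Then (1) $\|p\|\,(1+\|r\|^2)^{1/2}\le\|a\|\,f(a)$; (2) $\lambda\ge 1/f(a)$; (3) $\|r\|/\lambda\le 2f(a)$.
   Context: $\|\cdot\|$ is the Euclidean norm and $I$ is the $n\times n$ identity matrix. For an $n$-vector $a$, $f(a)=2^{n/4}/\|a\|^{1/n}$. A square integral matrix $U$ is unimodular if $\det U=\pm1$. LLL-reducedness: linearly independent vectors $b_1,\dots,b_k$ with Gram–Schmidt orthogonalization $b_1^*,\dots,b_k^*$, i.e. $b_1=b_1^*$ and $b_i=b_i^*+\sum_{j<i}\mu_{ij}b_j^*$ with $\mu_{ij}=b_i^Tb_j^*/\|b_j^*\|^2$, are LLL-reduced if $|\mu_{ij}|\le 1/2$ for all $1\le j<i\le k$ and $\|b_i^*\|^2\le 2\|b_{i+1}^*\|^2$ for all $1\le i\le k-1$. *)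

(* Defs.v *)
From mathcomp Require Export all_boot all_order all_algebra.
From mathcomp Require Export reals exp.

Set Implicit Arguments.
Unset Strict Implicit.
Unset Printing Implicit Defensive.

Import Order.TTheory GRing.Theory Num.Theory.
Local Open Scope ring_scope.

(* Entrywise inner product, used for both row and column vectors. *)
Definition dotv (R : pzRingType) (m n : nat) (u v : 'M[R]_(m, n)) : R :=
  \sum_(i < m) \sum_(j < n) u i j * v i j.

Definition eucl_norm (R : rcfType) (m n : nat) (u : 'M[R]_(m, n)) : R :=
  Num.sqrt (dotv u u).

Definition gs_mu (R : rcfType) (m k : nat) (B Bs : 'M[R]_(m, k)) (i j : 'I_k) : R :=
  dotv (col i B) (col j Bs) / eucl_norm (col j Bs) ^+ 2.

(* The columns of Bs are the Gram-Schmidt vectors of the columns of B. By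
   recursion on i the equations determine Bs uniquely; for the first column
   the sum is empty. *)
Definition gram_schmidt (R : rcfType) (m k : nat) (B Bs : 'M[R]_(m, k)) : Prop :=
  forall i : 'I_k,
    col i B = col i Bs + \sum_(j < k | (j < i)%N) gs_mu B Bs i j *: col j Bs.

Definition LLL_reduced (R : rcfType) (m k : nat) (B : 'M[R]_(m, k)) : Prop :=
  row_free B^T /\
  exists Bs : 'M[R]_(m, k),
    [/\ gram_schmidt B Bs,
        forall i j : 'I_k, (j < i)%N -> `|gs_mu B Bs i j| <= 2^-1
      & forall i j : 'I_k, j = i.+1 :> nat ->
          eucl_norm (col i Bs) ^+ 2 <= 2 * eucl_norm (col j Bs) ^+ 2].

Definition unimodular (n : nat) (U : 'M[int]_n) : Prop :=
  \det U = 1 \/ \det U = -1.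

Definition f_of (R : realType) (n : nat) (a : 'rV[R]_n) : R :=
  2 `^ (n%:R / 4) / eucl_norm a `^ (n%:R^-1).

(* Main.v *)
(* Write A = |a|^2, P = |p|^2, rho = |r|^2, N for the dimension, and b_i^* for
   the Gram-Schmidt vectors of the reduced basis. The lattice has squared
   determinant det (I + a^T a) = 1 + A, and p generates the direction dual to
   the last basis vector, so P - (a.p)^2 / (1 + A) is the squared length
   1 / |b_N^*|^2 of the last dual vector; as a.p = lambda P, this says
   P (1 + rho) |b_N^*|^2 = 1 + A. The Lovasz condition gives
   1 + A <= 2^(N(N-1)/2) |b_N^*|^(2N), which bounds P (1 + rho) by A f^2: this
   is (1). The hypothesis on |a| makes f^2 <= 1/4, hence rho <= A/4 - 1, and
   (2) and (3) follow from (1) by elementary estimates on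
   A = lambda^2 P + rho. *)
Require Import Defs.
From mathcomp Require Import ring lra zify.

Set Implicit Arguments.
Unset Strict Implicit.
Unset Printing Implicit Defensive.

Import Order.TTheory GRing.Theory Num.Theory.
Local Open Scope ring_scope.

(** * Inner products and norms *)

Lemma dotvE (R : comPzRingType) (m n : nat) (u v : 'M[R]_(m, n)) :
  dotv u v = \tr (u *m v^T).
Proof.
by apply: eq_bigr => i _; rewrite mxE; apply: eq_bigr => j _; rewrite mxE.
Qed.

Lemma dotvC (R : comPzRingType) (m n : nat) (u v : 'M[R]_(m, n)) :
  dotv u v = dotv v u.
Proof. by rewrite !dotvE -mxtrace_tr trmx_mul trmxK. Qed.

Lemma dotvDl (R : comPzRingType) (m n : nat) (u v w : 'M[R]_(m, n)) :
  dotv (u + v) w = dotv u w + dotv v w.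
Proof. by rewrite !dotvE mulmxDl raddfD. Qed.

Lemma dotvZl (R : comPzRingType) (m n : nat) (c : R) (u w : 'M[R]_(m, n)) :
  dotv (c *: u) w = c * dotv u w.
Proof. by rewrite !dotvE -scalemxAl mxtraceZ. Qed.

Lemma dotv_suml (R : comPzRingType) (m n : nat) (I : finType) (P : pred I)
    (F : I -> 'M[R]_(m, n)) (w : 'M[R]_(m, n)) :
  dotv (\sum_(i | P i) F i) w = \sum_(i | P i) dotv (F i) w.
Proof.
rewrite dotvE mulmx_suml raddf_sum.
by apply: eq_bigr => i _; rewrite dotvE.
Qed.

Lemma dotv_row (R : comPzRingType) (n : nat) (u v : 'rV[R]_n) :
  dotv u v = (u *m v^T) 0 0.
Proof. by rewrite dotvE /mxtrace big_ord1. Qed.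

Lemma dotv_col (R : comPzRingType) (m k l : nat) (B : 'M[R]_(m, k))
    (C : 'M[R]_(m, l)) (i : 'I_k) (j : 'I_l) :
  dotv (col i B) (col j C) = (B^T *m C) i j.
Proof. by rewrite mxE; apply: eq_bigr => s _; rewrite big_ord1 !mxE. Qed.

Lemma dotv_ge0 (R : realDomainType) (m n : nat) (u : 'M[R]_(m, n)) :
  0 <= dotv u u.
Proof. by apply: sumr_ge0 => i _; apply: sumr_ge0 => j _; exact: sqr_ge0. Qed.

Lemma dotv_eq0 (R : realDomainType) (m n : nat) (u : 'M[R]_(m, n)) :
  dotv u u = 0 -> u = 0.
Proof.
move=> u0; apply/matrixP => i j; rewrite mxE.
have ge0 k l : 0 <= u k l * u k l by exact: sqr_ge0.
have /eqP :=
  @psumr_eq0P R _ predT _ (fun k _ => sumr_ge0 _ (fun l _ => ge0 k l)) u0 i isT.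
rewrite psumr_eq0 // => /allP/(_ j); rewrite mem_index_enum => /(_ isT).
by rewrite mulf_eq0 orbb => /eqP.
Qed.

Lemma eucl_norm_sqr (R : rcfType) (m n : nat) (u : 'M[R]_(m, n)) :
  eucl_norm u ^+ 2 = dotv u u.
Proof. by rewrite sqr_sqrtr // dotv_ge0. Qed.

(** * Gram-Schmidt vectors and the Gram matrix *)

(** Induction on a bound [d] for the larger index. Pairing the equation for column [i] with column
    [j] of [Bs] kills every term of the sum except the [j]-th, which is exactly the left-hand
    side. *)
Lemma gram_schmidt_orthogonal (R : rcfType) (m k : nat) (B Bs : 'M[R]_(m, k)) :
  gram_schmidt B Bs ->
  forall i j : 'I_k, i != j -> dotv (col i Bs) (col j Bs) = 0.
Proof.
move=> GS.
suff lt_orth d (i j : 'I_k) : (i < d)%N -> (j < i)%N ->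
    dotv (col i Bs) (col j Bs) = 0.
  move=> i j; rewrite -val_eqE neq_ltn => /orP[] lt; last exact: (lt_orth k).
  by rewrite dotvC (lt_orth k).
elim: d i j => // d IH i j; rewrite ltnS => le_id lt_ji.
have := congr1 (fun u => dotv u (col j Bs)) (GS i).
rewrite /= dotvDl dotv_suml (bigD1 j) //= big1 => [|l /andP[lt_li ne_lj]]; last first.
  move: ne_lj; rewrite dotvZl -val_eqE neq_ltn => /orP[] lt.
    by rewrite dotvC IH ?mulr0 // (leq_trans lt_ji).
  by rewrite IH ?mulr0 // (leq_trans lt_li).
rewrite addr0 dotvZl /gs_mu eucl_norm_sqr.
(* If this vector vanishes, [gs_mu] divides by zero, but the claim is then trivial. *)
have [/dotv_eq0 -> _|nz] := eqVneq (dotv (col j Bs) (col j Bs)) 0.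
  by rewrite dotvE trmx0 mulmx0 mxtrace0.
by rewrite divfK // => /esym/(canRL (addrK _)); rewrite subrr.
Qed.

(** Column [i] lists the coordinates of [col i B] in the Gram-Schmidt vectors, hence the swapped
    indices and the upper unitriangular shape. *)
Definition gs_coef (R : rcfType) (m k : nat) (B Bs : 'M[R]_(m, k)) : 'M[R]_k :=
  \matrix_(j, i) (if (j < i)%N then gs_mu B Bs i j else (j == i)%:R).

Lemma gram_schmidt_mul (R : rcfType) (m k : nat) (B Bs : 'M[R]_(m, k)) :
  gram_schmidt B Bs -> B = Bs *m gs_coef B Bs.
Proof.
move=> GS; apply/matrixP => s i.
have := congr1 (fun u : 'cV_m => u s 0) (GS i).
rewrite /= !mxE summxE => ->.
rewrite [RHS](bigID (fun j : 'I_k => (j < i)%N)) /= [RHS]addrC; congr (_ + _).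
  rewrite (bigD1 i) ?ltnn //= big1 => [|j /andP[ge ne]].
    by rewrite mxE ltnn eqxx mulr1 addr0.
  by rewrite mxE (negPf ge) (negPf ne) mulr0.
by apply: eq_bigr => j lt; rewrite !mxE lt mulrC.
Qed.

Lemma gs_coef_diag (R : rcfType) (m k : nat) (B Bs : 'M[R]_(m, k)) i :
  gs_coef B Bs i i = 1.
Proof. by rewrite mxE ltnn eqxx. Qed.

Lemma det_gs_coef (R : rcfType) (m k : nat) (B Bs : 'M[R]_(m, k)) :
  \det (gs_coef B Bs) = 1.
Proof.
rewrite -det_tr det_trig.
  by rewrite big1 // => i _; rewrite mxE gs_coef_diag.
apply/is_trig_mxP => i j lt; rewrite !mxE ltnNge ltnW //=.
by rewrite -val_eqE gtn_eqF.
Qed.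

(** The LDL^T factorization: orthogonality makes [Bs^T *m Bs] diagonal. *)
Lemma gram_schmidt_gram (R : rcfType) (m k : nat) (B Bs : 'M[R]_(m, k)) :
  gram_schmidt B Bs ->
  B^T *m B = (gs_coef B Bs)^T *m
    diag_mx (\row_i eucl_norm (col i Bs) ^+ 2) *m gs_coef B Bs.
Proof.
move=> GS; rewrite {1 2}(gram_schmidt_mul GS) trmx_mul !mulmxA.
congr (_ *m _); rewrite -!mulmxA; congr (_ *m _).
apply/matrixP => i j; rewrite -dotv_col !mxE eucl_norm_sqr.
have [->|ne] := eqVneq i j; first by rewrite mulr1n.
by rewrite mulr0n (gram_schmidt_orthogonal GS).
Qed.

Lemma det_gram (R : rcfType) (m k : nat) (B Bs : 'M[R]_(m, k)) :
  gram_schmidt B Bs ->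
  \det (B^T *m B) = \prod_i eucl_norm (col i Bs) ^+ 2.
Proof.
move=> GS; rewrite (gram_schmidt_gram GS) !det_mulmx det_tr det_gs_coef.
by rewrite mul1r mulr1 det_diag; apply: eq_bigr => i _; rewrite mxE.
Qed.

(** Here [v] holds the coordinates of [c] times the last dual basis vector. The last row of the
    unitriangular factor [T] is the last unit row, so [T] cancels on the right, and multiplying [v]
    by [T^T] preserves its last entry. *)
Lemma gram_schmidt_dual_last (R : rcfType) (m k : nat)
    (B Bs : 'M[R]_(m, k.+1)) (v : 'rV[R]_k.+1) (c : R) :
  gram_schmidt B Bs -> v *m (B^T *m B) = c *: delta_mx 0 ord_max ->
  v 0 ord_max * eucl_norm (col ord_max Bs) ^+ 2 = c.
Proof.
move=> GS; set T := gs_coef B Bs; set e := delta_mx _ _.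
have rowT : e *m T = e.
  rewrite -rowE; apply/rowP => i; rewrite !mxE ltnNge -ltnS ltn_ord /=.
  by rewrite [ord_max == i]eq_sym.
have uT : T \in unitmx by rewrite unitmxE det_gs_coef unitr1.
rewrite (gram_schmidt_gram GS) -/T -rowT scalemxAl mulmxA => /(can_inj (mulmxK uT)).
move=> /(congr1 (fun u : 'rV_k.+1 => u 0 ord_max)).
rewrite mulmxA mul_mx_diag !mxE !eqxx mulr1 => <-; congr (_ * _).
rewrite (bigD1 ord_max) //= big1 => [|j ne].
  by rewrite mxE gs_coef_diag mulr1 addr0.
rewrite !mxE ltnNge -ltnS ltn_ord /=.
by rewrite [ord_max == j]eq_sym (negPf ne) mulr0.
Qed.

(** * Consequences of the Lovasz condition *)

Lemma lll_geometric_decay (R : rcfType) (m k : nat) (B Bs : 'M[R]_(m, k.+1)) :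
  (forall i j : 'I_k.+1, j = i.+1 :> nat ->
     eucl_norm (col i Bs) ^+ 2 <= 2 * eucl_norm (col j Bs) ^+ 2) ->
  forall i : 'I_k.+1, eucl_norm (col i Bs) ^+ 2
    <= 2 ^+ (k - i) * eucl_norm (col ord_max Bs) ^+ 2.
Proof.
move=> step i; move def_d: (k - i)%N => d.
elim: d i def_d => [|d IH] i def_d.
  suff -> : i = ord_max by rewrite mul1r.
  by apply/val_inj/eqP; rewrite eqn_leq -ltnS ltn_ord /= -subn_eq0 def_d.
have lt_ik : (i < k)%N by rewrite -subn_gt0 def_d.
pose j := Ordinal (lt_ik : (i.+1 < k.+1)%N).
apply: le_trans (step i j erefl) _.
by rewrite (exprS 2 d) -mulrA ler_pM2l // IH //= subnS def_d.
Qed.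

(** The determinant is squared so that the exponent k(k+1)/2, the sum of the decay exponents, need
    not be halved. *)
Lemma det_gram_le (R : rcfType) (m k : nat) (B Bs : 'M[R]_(m, k.+1)) :
  gram_schmidt B Bs ->
  (forall i j : 'I_k.+1, j = i.+1 :> nat ->
     eucl_norm (col i Bs) ^+ 2 <= 2 * eucl_norm (col j Bs) ^+ 2) ->
  \det (B^T *m B) ^+ 2
    <= 2 ^+ (k.+1 * k) * (eucl_norm (col ord_max Bs) ^+ 2) ^+ (2 * k.+1).
Proof.
move=> GS /lll_geometric_decay decay; rewrite (det_gram GS).
set d := eucl_norm (col ord_max Bs) ^+ 2 in decay *.
have sum_k : (\sum_(i < k.+1) (k - i) * 2 = k.+1 * k)%N.
  rewrite -big_distrl /= (reindex_inj rev_ord_inj) /=.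
  under eq_bigr => i _ do rewrite subSS subKn -1?ltnS //.
  by rewrite -(big_mkord predT id) bin2_sum muln2 bin2 even_halfK // oddM /= andNb.
apply: (@le_trans _ _ ((2 ^+ (\sum_(i < k.+1) (k - i)) * d ^+ k.+1) ^+ 2)).
  apply: lerXn2r; rewrite ?nnegrE.
  - by apply: prodr_ge0 => i _; exact: sqr_ge0.
  - by rewrite mulr_ge0 ?exprn_ge0 ?ler0n ?sqrtr_ge0.
  rewrite -prodrXr -[X in d ^+ X]card_ord -prodr_const -big_split /=.
  by apply: ler_prod => i _; rewrite sqr_ge0 decay.
by rewrite exprMn -!exprM [(k.+1 * 2)%N]mulnC big_distrl sum_k.
Qed.

(** * The lattice spanned by the columns of [col_mx a 1%:M] *)

(** Column operations of determinant 1 on the bordered matrix [M] clear either off-diagonal block;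
    the two resulting triangular determinants agree. *)
Lemma det_1addmul_tr (R : comPzRingType) (n : nat) (a : 'rV[R]_n) :
  \det (1%:M + a^T *m a) = 1 + dotv a a.
Proof.
pose M := block_mx (1%:M : 'M_1) a (- a^T) 1%:M.
have : \det (M *m block_mx 1%:M (- a) 0 1%:M)
     = \det (M *m block_mx 1%:M 0 a^T 1%:M).
  by rewrite !det_mulmx det_ublock det_lblock !det1.
rewrite !mulmx_block !mulmx1 !mul1mx !mulmx0 !mulNmx !mulmxN !opprK addNr !addr0 !add0r.
rewrite addNr det_lblock det_ublock !det1 mul1r mulr1 addrC => ->.
by rewrite det_mx11 dotv_row !mxE eqxx.
Qed.

Lemma gram_col_mx1 (R : comPzRingType) (n k : nat) (a : 'rV[R]_n) (U : 'M[R]_(n, k)) :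
  (col_mx a 1%:M *m U)^T *m (col_mx a 1%:M *m U)
    = U^T *m (1%:M + a^T *m a) *m U.
Proof.
rewrite trmx_mul tr_col_mx trmx1 !mulmxA; congr (_ *m _).
by rewrite -mulmxA mul_row_col mulmx1 addrC.
Qed.

Lemma det_gram_col_mx1 (R : comPzRingType) (n : nat) (a : 'rV[R]_n) (U : 'M[R]_n) :
  \det U ^+ 2 = 1 ->
  \det ((col_mx a 1%:M *m U)^T *m (col_mx a 1%:M *m U)) = 1 + dotv a a.
Proof.
move=> detU; rewrite gram_col_mx1 !det_mulmx det_tr det_1addmul_tr.
by rewrite mulrAC -expr2 detU mul1r.
Qed.

(** With G = I + a^T a and x = p G^-1, the row x U^-T represents [c] times the last dual vector in
    the reduced basis. Its last entry times [c] is x.p, and times the squared last Gram-Schmidt norm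
    it is [c]. *)
Lemma last_gram_schmidt_norm (R : rcfType) (n : nat) (a p : 'rV[R]_n.+1)
    (U : 'M[R]_n.+1) (Bs : 'M[R]_(1 + n.+1, n.+1)) (c : R) :
  U \in unitmx -> p *m U = c *: delta_mx 0 ord_max ->
  gram_schmidt (col_mx a 1%:M *m U) Bs ->
  (dotv p p - dotv a p ^+ 2 / (1 + dotv a a))
    * eucl_norm (col ord_max Bs) ^+ 2 = c ^+ 2.
Proof.
(* The Sherman-Morrison formula for p G^-1. *)
move=> uU pU GS; pose x := p - (dotv a p / (1 + dotv a a)) *: a.
have A_neq0 : 1 + dotv a a != 0 by rewrite gt_eqF // ltr_wpDr // dotv_ge0.
have xG : x *m (1%:M + a^T *m a) = p.
  have rank1 u : u *m (a^T *m a) = dotv u a *: a.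
    by rewrite mulmxA [u *m _]mx11_scalar mul_scalar_mx dotv_row.
  rewrite mulmxDr mulmx1 rank1 /x -!scaleNr dotvDl dotvZl dotvC -addrA -scalerDl.
  by rewrite [X in X *: a](_ : _ = 0) ?scale0r ?addr0 //; field.
have uUT : U^T \in unitmx by rewrite unitmx_tr.
have := @gram_schmidt_dual_last _ _ _ _ _ (x *m invmx U^T) c GS.
rewrite gram_col_mx1 !mulmxA mulmxKV // xG => /(_ pU) dual.
rewrite [c ^+ 2]expr2 -[X in _ = c * X]dual mulrA; congr (_ * _).
have <- : dotv x p = c * (x *m invmx U^T) 0 ord_max.
  have -> : dotv x p = (x *m invmx U^T *m (p *m U)^T) 0 0.
    by rewrite dotv_row trmx_mul mulmxA mulmxKV.
  by rewrite pU linearZ /= trmx_delta -scalemxAr -colE !mxE.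
by rewrite dotvDl -scaleNr dotvZl; field.
Qed.

(** * Estimates in an ordered field *)

(* [F] stands for [f_of a ^+ 2], [A] for the squared norm of [a], [d] for that of
   the last Gram-Schmidt vector, and [Q] for [|p|^2 (1 + |r|^2)]. *)
Lemma sublattice_norm_le (R : realFieldType) (k : nat) (A F d Q : R) :
  0 <= F -> 0 < d -> 8 <= A ->
  F ^+ (2 * k.+1) * A ^+ 2 = 2 ^+ (k.+1 * k.+1) ->
  (1 + A) ^+ 2 <= 2 ^+ (k.+1 * k) * d ^+ (2 * k.+1) ->
  0 <= Q -> Q * d = 1 + A -> Q <= A * F.
Proof.
move=> F_ge0 d_gt0 A_ge8 defF lll Q_ge0 defQ.
have A_ge0 : 0 <= A by lra.
rewrite -(@ler_pXn2r _ (2 * k.+1)) ?nnegrE ?mulr_ge0 //.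
rewrite -(ler_pM2r (exprn_gt0 (2 * k.+1) d_gt0)) -exprMn defQ.
have -> : (2 * k.+1 = 2 * k + 2)%N by rewrite mulnS addnC.
rewrite exprD [(A * F) ^+ _]exprMn exprD -[(2 * k + 2)%N](addnC 2%N) -mulnS.
rewrite -(mulrA (A ^+ (2 * k))) [A ^+ 2 * _]mulrC defF.
(* Since A >= 8, (1 + A)^2 <= 2 A^2; this trades [k] of the [k.+1] factors (1 + A)^2 for a factor
   2^k, and [lll] bounds the remaining one. The total exponent k + (k+1)k of 2 still fits below
   (k+1)^2. *)
apply: (@le_trans _ _ (2 ^+ k * A ^+ (2 * k) * (2 ^+ (k.+1 * k) * d ^+ (2 * k.+1)))).
  apply: ler_pM => //; rewrite ?exprn_ge0 //; try lra.
  rewrite [(1 + A) ^+ _]exprM [A ^+ (2 * k)]exprM -exprMn.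
  by apply: lerXn2r; rewrite ?nnegrE; nra.
rewrite (_ : _ * (_ * _) = A ^+ (2 * k) * (2 ^+ k * 2 ^+ (k.+1 * k)) * d ^+ (2 * k.+1)).
  apply: ler_wpM2r; first by rewrite exprn_ge0 ?ltW.
  apply: ler_wpM2l; first by rewrite exprn_ge0.
  by rewrite -exprD ler_weXn2l ?ler1n //; lia.
by rewrite [2 ^+ k * A ^+ _]mulrC !mulrA.
Qed.

(** With N = k+1, the 2N-th power of the claim amounts to 2^(N^2 + 4N) <= A^2. *)
Lemma sqr_f_le_quarter (R : realFieldType) (k : nat) (A F : R) :
  0 <= F -> 2 ^+ (2 * k.+1 * k.+1 + 4 * k.+1) <= A ^+ 2 ->
  F ^+ (2 * k.+1) * A ^+ 2 = 2 ^+ (k.+1 * k.+1) -> F <= 4^-1.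
Proof.
move=> F_ge0 A_large defF.
have A2_gt0 : 0 < A ^+ 2 by apply: lt_le_trans A_large; rewrite exprn_gt0.
rewrite -(@ler_pXn2r _ (2 * k.+1)) ?nnegrE ?invr_ge0 //.
rewrite -(ler_pM2r A2_gt0) defF exprVn ler_pdivlMl ?exprn_gt0 //.
apply: le_trans A_large; rewrite (_ : 4 = 2 ^+ 2) -?exprM -?exprD; last by ring.
by rewrite ler_weXn2l ?ler1n //; lia.
Qed.

(** The hypotheses give 1 + rho <= A/4, and l^2 P = A - rho. The first bound rests on (1 + rho)(A -
    rho) - A = rho (A - 1 - rho) >= 0, the second on rho P <= A F and A <= 4 (A - rho). *)
Lemma multiplier_bounds (R : realFieldType) (A P rho l F : R) :
  1 <= P -> 0 <= rho -> A = l ^+ 2 * P + rho -> 1 <= A -> 0 <= F -> F <= 4^-1 ->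
  P * (1 + rho) <= A * F -> 1 <= l ^+ 2 * F /\ rho <= 4 * F * l ^+ 2.
Proof.
move=> P_ge1 rho_ge0 defA A_ge1 F_ge0 F_le bound.
have A_ge0 : 0 <= A by lra.
have AF : A * F <= A * 4^-1 by rewrite ler_wpM2l.
have P1 : 1 + rho <= P * (1 + rho) by rewrite ler_peMl; lra.
have P_gt0 : 0 < P by lra.
have A_gt0 : 0 < A by lra.
split.
  rewrite -(ler_pM2l P_gt0) -(ler_pM2l A_gt0) mulr1.
  have -> : A * (P * (l ^+ 2 * F)) = (A * F) * (A - rho) by rewrite defA; ring.
  apply: le_trans (_ : P * (1 + rho) * (A - rho) <= _); last first.
    by rewrite ler_wpM2r //; lra.
  rewrite mulrC -mulrA ler_wpM2l //; first lra.
  by rewrite -subr_ge0 (_ : _ - A = rho * (A - 1 - rho)); [apply: mulr_ge0; lra | ring].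
rewrite -(ler_pM2r P_gt0).
have -> : 4 * F * l ^+ 2 * P = F * (4 * (A - rho)) by rewrite defA; ring.
apply: (@le_trans _ _ (F * A)); first nra.
by rewrite ler_wpM2l //; lra.
Qed.

(** * From real exponents to natural ones *)

(** The total exponent 4n on f clears both the quarter in 2^(n/4) and the n-th root of the norm. *)
Lemma f_of_expn (R : realType) (n : nat) (a : 'rV[R]_n.+1) :
  0 < eucl_norm a ->
  (f_of a ^+ 2) ^+ (2 * n.+1) * dotv a a ^+ 2 = 2 ^+ (n.+1 * n.+1).
Proof.
move=> a_gt0; have n_neq0 : n.+1%:R != 0 :> R by rewrite pnatr_eq0.
rewrite -exprM /f_of expr_div_n -eucl_norm_sqr -exprM.
rewrite -!(@powR_mulrn _ (_ `^ _)) ?powR_ge0 // -!powRrM.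
rewrite (_ : n.+1%:R^-1 * _ = 4%:R); last by rewrite !natrM; field; rewrite nat1r.
rewrite (_ : _ / 4 * _ = (n.+1 * n.+1)%:R); last by rewrite !natrM; field.
by rewrite !powR_mulrn ?ltW // divfK // expf_neq0 // gt_eqF.
Qed.

Lemma powR_expn_le (R : realType) (n : nat) (x : R) :
  2 `^ ((n.+1%:R / 2 + 1) * n.+1%:R) <= x ->
  2 ^+ (2 * n.+1 * n.+1 + 4 * n.+1) <= (x ^+ 2) ^+ 2.
Proof.
move=> le_x; rewrite -exprM.
apply: le_trans (_ : (2 `^ ((n.+1%:R / 2 + 1) * n.+1%:R)) ^+ 4 <= _).
  rewrite -[_ ^+ 4]powR_mulrn ?powR_ge0 // -powRrM -powR_mulrn //.
  by rewrite (_ : _ * 4 = (2 * n.+1 * n.+1 + 4 * n.+1)%:R) // natrD !natrM; field.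
by apply: lerXn2r => //; rewrite nnegrE ?(le_trans _ le_x) ?powR_ge0.
Qed.

Theorem theorem3 (R : realType) (n : nat) (a : 'rV[int]_n.+1)
  (a_gt0 : forall i, 0 < a 0 i)
  (a_gcd : \big[gcdn/0%N]_(i < n.+1) absz (a 0 i) = 1%N)
  (a_large : 2 `^ ((n.+1%:R / 2 + 1) * n.+1%:R)
               <= eucl_norm (map_mx intr a : 'rV[R]_n.+1))
  (U : 'M[int]_n.+1)
  (U_unimod : unimodular U)
  (U_LLL : LLL_reduced
             (map_mx intr (col_mx a 1%:M *m U) : 'M[R]_(1 + n.+1, n.+1)))
  (p : 'rV[int]_n.+1)
  (p_last : p = row ord_max (invmx U) \/ p = - row ord_max (invmx U))
  (lambda : rat) (r : 'rV[rat]_n.+1)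
  (a_decomp : map_mx intr a = lambda *: map_mx intr p + r)
  (r_perp : dotv r (map_mx intr p) = 0) :
  let aR : 'rV[R]_n.+1 := map_mx intr a in
  let pR : 'rV[R]_n.+1 := map_mx intr p in
  let rR : 'rV[R]_n.+1 := map_mx ratr r in
  lambda != 0 /\
  (0 < lambda ->
   [/\ eucl_norm pR * Num.sqrt (1 + eucl_norm rR ^+ 2) <= eucl_norm aR * f_of aR,
       (f_of aR)^-1 <= ratr lambda
     & eucl_norm rR / ratr lambda <= 2 * f_of aR]).
Proof.
move=> aR pR rR.
have U_unit : U \in unitmx.
  by rewrite unitmxE; case: U_unimod => ->; rewrite ?unitrN unitr1.
(* The sign [c] treats both choices of [p] at once. *)
have [c c_sqr pU] : exists2 c : int, c ^+ 2 = 1 & p *m U = c *: delta_mx 0 ord_max.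
  have lastU : row ord_max (invmx U) *m U = delta_mx 0 ord_max.
    by rewrite -row_mul mulVmx // row1.
  case: p_last => ->; [exists 1 | exists (-1)] => //.
    by rewrite lastU scale1r.
  by rewrite mulNmx lastU scaleN1r.
pose UR : 'M[R]_n.+1 := map_mx intr U; pose cR : R := c%:~R.
have cR_sqr : cR ^+ 2 = 1 by rewrite -rmorphXn c_sqr.
have pUR : pR *m UR = cR *: delta_mx 0 ord_max.
  by rewrite -map_mxM pU map_mxZ map_delta_mx.
have detUR : \det UR ^+ 2 = 1.
  by rewrite det_map_mx; case: U_unimod => ->; rewrite ?rmorphN rmorph1 ?sqrrN expr1n.
have UR_unit : UR \in unitmx.
  by rewrite unitmxE unitfE -sqrf_eq0 detUR oner_eq0.
have defB : map_mx intr (col_mx a 1%:M *m U) = col_mx aR 1%:M *m UR.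
  by rewrite map_mxM map_col_mx map_mx1.
move: U_LLL; rewrite defB => -[_ [Bs [GS _ lovasz]]].
set A := dotv aR aR; set P := dotv pR pR; set rho := dotv rR rR.
set l : R := ratr lambda; set f := f_of aR.
set d := eucl_norm (col ord_max Bs) ^+ 2.
have aR_decomp : aR = l *: pR + rR.
  apply/rowP => i; have := congr1 (fun u : 'rV_n.+1 => ratr (u 0 i) : R) a_decomp.
  by rewrite /= !mxE rmorphD rmorphM /= !ratr_int.
have rpR : dotv rR pR = 0.
  rewrite -[RHS](rmorph0 (@ratr R)) -r_perp rmorph_sum.
  apply: eq_bigr => i _; rewrite rmorph_sum; apply: eq_bigr => j _.
  by rewrite !mxE rmorphM /= ratr_int.
have dot_ap : dotv aR pR = l * P.
  by rewrite aR_decomp dotvDl dotvZl rpR addr0.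
have defA : A = l ^+ 2 * P + rho.
  rewrite /A {1}aR_decomp dotvDl dotvZl [dotv pR _]dotvC dot_ap [dotv rR _]dotvC.
  by rewrite aR_decomp dotvDl dotvZl [dotv pR _]dotvC rpR mulr0 add0r mulrA.
have normA : eucl_norm aR ^+ 2 = A by exact: eucl_norm_sqr.
have aR_gt0 : 0 < eucl_norm aR.
  by apply: lt_le_trans a_large; rewrite powR_gt0.
have f_gt0 : 0 < f by rewrite divr_gt0 ?powR_gt0.
have defF := f_of_expn aR_gt0; rewrite -/A -/f in defF.
have A_large : 2 ^+ (2 * n.+1 * n.+1 + 4 * n.+1) <= A ^+ 2.
  by rewrite -normA; exact: powR_expn_le.
have A_ge0 : 0 <= A by exact: dotv_ge0.
(* As the dimension is at least 1, the exponent in [A_large] is at least 6. *)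
have A_ge8 : 8 <= A.
  rewrite -(@ler_pXn2r _ 2) ?nnegrE //; apply: le_trans A_large.
  rewrite (_ : 8 = 2 ^+ 3); last by ring.
  by rewrite -exprM ler_weXn2l ?ler1n //; lia.
have rho_ge0 : 0 <= rho by exact: dotv_ge0.
(* [p] is integral, and p = 0 would force c = 0. *)
have P_ge1 : 1 <= P.
  have -> : P = (dotv p p)%:~R.
    rewrite rmorph_sum; apply: eq_bigr => i _; rewrite rmorph_sum.
    by apply: eq_bigr => j _; rewrite !mxE rmorphM.
  rewrite ler1z -gtz0_ge1 lt0r dotv_ge0 andbT.
  apply/eqP => /dotv_eq0 p0; move: pU; rewrite p0 mul0mx.
  move=> /(congr1 (fun u : 'rV_n.+1 => u 0 ord_max)); rewrite !mxE !eqxx mulr1 => c0.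
  by move: c_sqr; rewrite -c0.
(* Clearing the denominator: (1 + A) P - l^2 P^2 = P (1 + A - l^2 P) = P (1 + rho). *)
have dual : P * (1 + rho) * d = 1 + A.
  have := last_gram_schmidt_norm UR_unit pUR GS; rewrite -/P -/A -/d dot_ap cR_sqr.
  have A1_neq0 : 1 + A != 0 by rewrite gt_eqF //; lra.
  move=> /(congr1 (fun x => (1 + A) * x)); rewrite mulr1 => <-.
  rewrite [RHS]mulrA; congr (_ * d); rewrite mulrBr mulrCA divff //.
  by rewrite defA; ring.
have d_gt0 : 0 < d.
  rewrite lt0r sqr_ge0 andbT; apply/eqP => d0; move: dual; rewrite d0 mulr0; lra.
have lll : (1 + A) ^+ 2 <= 2 ^+ (n.+1 * n) * d ^+ (2 * n.+1).
  by rewrite -(det_gram_col_mx1 aR detUR); exact: det_gram_le.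
have f2_ge0 : 0 <= f ^+ 2 by exact: sqr_ge0.
have bound : P * (1 + rho) <= A * f ^+ 2.
  by apply: sublattice_norm_le defF lll _ dual => //; apply: mulr_ge0; lra.
have f_le := sqr_f_le_quarter f2_ge0 A_large defF.
have A_ge1 : 1 <= A by lra.
have [lf rf] := multiplier_bounds P_ge1 rho_ge0 defA A_ge1 f2_ge0 f_le bound.
(* A zero [lambda] would contradict 1 <= l^2 f^2; the three bounds are then compared through their
   squares. *)
split=> [|lambda_gt0].
  apply/eqP => lambda0; move: lf; rewrite /l lambda0 rmorph0 expr0n mul0r; lra.
have l_gt0 : 0 < l by rewrite ltr0q.
have sqr_le (x y : R) : 0 <= y -> x ^+ 2 <= y ^+ 2 -> x <= y.
  by move=> y_ge0 le_xy; nra.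
split.
- apply: sqr_le; first by rewrite mulr_ge0 ?ltW.
  by rewrite [leLHS]exprMn [leRHS]exprMn normA !eucl_norm_sqr sqr_sqrtr ?addr_ge0.
- apply: sqr_le; first exact: ltW.
  by rewrite exprVn -[leLHS]mul1r ler_pdivrMr ?exprn_gt0.
- apply: sqr_le; first by rewrite mulr_ge0 ?ltW.
  rewrite expr_div_n eucl_norm_sqr ler_pdivrMr ?exprn_gt0 //.
  by rewrite exprMn (_ : 2 ^+ 2 = 4) //; ring.
Qed.
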